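(* Let $\Delta>1$ and let $\nu=(\nu_x)_{x\in\mathbb{Z}}$ be a bounded sequence of non-negative real numbers. For all $N=0,1,2,\dots$, $$H_{\mathbb{Z}}^N(\nu)=U^{-1}\left(h_{\mathbb{Z},a}^N(\nu)+N\cdot I\right)U,$$ where $H_{\mathbb{Z}}^N(\nu)$ is the restriction of the infinite XXZ chain Hamiltonian in exterior field $\nu$ to the $N$-particle subspace, $h_{\mathbb{Z},a}^N(\nu)$ is the restriction of the discrete $N$-body Schrödinger operator $h_{\mathbb{Z}}^N(\nu)$ to the antisymmetric subspace $\ell^2_a(\mathbb{Z}^N)$, and $U$ is the unitary operator identifying the canonical bases.
   Context: XXZ side. Let $M_N$ be the set of all $N$-element subsets of $\mathbb{Z}$ and $\ell^2(M_N)$ the Hilbert space with canonical orthonormal basis $(\phi_J)_{J\in M_N}$; $\phi_J$ represents the spin configuration with down-spins exactly at the sites in $J$. Let $\ell^2_0(M_N)$ be the finite linear combinations of the $\phi_J$, $J\in M_N$. For $x\in\mathbb{Z}$ let $t_{x,x+1}\phi_J=\phi_{\tau_x(J)}$, where $\tau_x$ is the transposition of $\mathbb{Z}$ exchanging $x$ and $x+1$; let $\pi_{x,x+1}\phi_J=\phi_J$ if $\#(J\cap\{x,x+1\})\in\{0,2\}$ and $\pi_{x,x+1}\phi_J=-\phi_J$ if $\#(J\cap\{x,x+1\})=1$; let $\mathcal{N}_x\phi_J=\phi_J$ if $x\in J$ and $\mathcal{N}_x\phi_J=0$ otherwise. Put $$h_{x,x+1}=-\frac{1}{2\Delta}(t_{x,x+1}-I)-\frac14\left(1-\frac1\Delta\right)(\pi_{x,x+1}-I).$$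 The operator $f\mapsto\sum_{x\in\mathbb{Z}}(h_{x,x+1}+\nu_x\mathcal{N}_x)f$ on $\ell^2_0(M_N)$ is well defined (only finitely many terms are non-zero for each $f$), bounded and symmetric; $H_{\mathbb{Z}}^N(\nu)$ is its bounded self-adjoint closure on $\mathcal{H}_{\mathbb{Z}}^N:=\ell^2(M_N)$. Schrödinger side. Let $h_{0,\mathbb{Z}}$ be the operator on $\ell^2(\mathbb{Z})$ given by $(h_{0,\mathbb{Z}}u)(x)=u(x-1)+u(x+1)$, and $(h_{0,\mathbb{Z}})_j$ the operator on $\ell^2(\mathbb{Z}^N)=\bigotimes_{j=1}^N\ell^2(\mathbb{Z})$ acting as $h_{0,\mathbb{Z}}$ on the $j$-th tensor component. Let $$h_{\mathbb{Z}}^N(\nu)=-\frac{1}{2\Delta}\sum_{j=1}^N(h_{0,\mathbb{Z}})_j+V+W,$$ where $V$ and $W$ are the multiplication operators by $V(x_1,\dots,x_N)=\nu_{x_1}+\dots+\nu_{x_N}$ and $W(x_1,\dots,x_N)=\sum_{1\le k<l\le N}Q(|x_k-x_l|)$, with $Q(r)=-1$ if $r=1$ and $Q(r)=0$ if $r\neq1$. Let $\ell^2_a(\mathbb{Z}^N)$ be the subspace of all $f\in\ell^2(\mathbb{Z}^N)$ with $f(x_{\sigma(1)},\dots,x_{\sigma(N)})=\mathrm{sgn}(\sigma)f(x_1,\dots,x_N)$ for all $\sigma\in S_N$; it is invariant under $h_{\mathbb{Z}}^N(\nu)$. For $N=0$ both $\ell^2(\mathbb{Z}^0)$ and $\ell^2_a(\mathbb{Z}^0)$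 are understood as $\mathbb{C}$, with $h_{\mathbb{Z}}^0(\nu)=0$. The unitary $U$. For $x_1<\dots<x_N$ let $\widetilde e_{(x_1,\dots,x_N)}=\frac{1}{\sqrt{N!}}\sum_{\sigma\in S_N}\mathrm{sgn}(\sigma)\,e_{x_{\sigma(1)}}\otimes\dots\otimes e_{x_{\sigma(N)}}$, where $e_x$ are the canonical basis vectors of $\ell^2(\mathbb{Z})$. $U:\mathcal{H}_{\mathbb{Z}}^N\to\ell^2_a(\mathbb{Z}^N)$ is the unique unitary operator with $U\phi_{\{x_1,\dots,x_N\}}=\widetilde e_{(x_1,\dots,x_N)}$ for all $x_1<\dots<x_N$. *)

(* Defs.v *)
From HB Require Import structures.
From mathcomp Require Import all_boot all_order all_algebra.
From mathcomp Require Import perm finmap.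
From mathcomp Require Import all_classical all_reals all_analysis.
From mathcomp Require Import complex.
From mathcomp Require Import ring lra zify.

Set Implicit Arguments.
Unset Strict Implicit.
Unset Printing Implicit Defensive.

Import Order.TTheory GRing.Theory Num.Theory.
Import numFieldNormedType.Exports Normc.

Local Open Scope classical_set_scope.
Local Open Scope ring_scope.
Local Open Scope complex_scope.

Section Esum.
Variables (R : realType) (I : choiceType).
Implicit Types a : I -> \bar R.

Lemma esumZ_le (c : R) a : 0 <= c -> (forall i, 0 <= a i)%E ->
  (\esum_(i in [set: I]) (c%:E * a i) <= c%:E * \esum_(i in [set: I]) a i)%E.
Proof.
move=> c0 a0; apply: ge_ereal_sup => _ [A [finA _] <-].
rewrite -ge0_mule_fsumr//; apply: lee_wpmul2l; first by rewrite lee_fin.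
by apply: ereal_sup_ubound; exists A.
Qed.

Lemma esumZ (c : R) a : 0 <= c -> (forall i, 0 <= a i)%E ->
  (\esum_(i in [set: I]) (c%:E * a i) = c%:E * \esum_(i in [set: I]) a i)%E.
Proof.
move=> c0 a0; have [->|cn0] := eqVneq c 0.
  by rewrite mul0e esum1// => i _; rewrite mul0e.
have cgt0 : 0 < c by rewrite lt0r cn0.
apply/eqP; rewrite eq_le esumZ_le//=.
have ic0 : 0 <= c^-1 by rewrite invr_ge0.
have H : (forall i, 0 <= c%:E * a i)%E by move=> i; rewrite mule_ge0// lee_fin.
have := esumZ_le ic0 H.
rewrite (_ : (fun i => (c^-1)%:E * (c%:E * a i))%E = a); last first.
  by apply/funext => i; rewrite muleA -EFinM mulVf// mul1e.
move=> h; apply: (le_trans (lee_wpmul2l _ h)); first by rewrite lee_fin.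
by rewrite muleA -EFinM divff// mul1e.
Qed.

Lemma esum_inj (J : choiceType) (s : J -> I) a : injective s ->
  (forall i, 0 <= a i)%E ->
  (\esum_(j in [set: J]) a (s j) <= \esum_(i in [set: I]) a i)%E.
Proof.
move=> sI a0; rewrite -(@esum_image _ _ _ setT s a); last by move=> x y _ _ /sI.
rewrite esum_mkcond; apply: le_esum => i _.
by case: ifP.
Qed.

End Esum.

Section Ell2.
Variables (R : realType) (I : choiceType).

Definition sqnorm (f : I -> R[i]) : \bar R :=
  \esum_(i in [set: I]) ((normc (f i)) ^+ 2)%:E.

Definition square_summable : {pred I -> R[i]^o} :=
  fun f => `[< (sqnorm f < +oo)%E >].

Record ell2 := Ell2 { ell2_fun :> I -> R[i]^o ;
                      _ : ell2_fun \in square_summable }.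

HB.instance Definition _ := [isSub for ell2_fun].
HB.instance Definition _ := [Choice of ell2 by <:].

Lemma sqnorm_ge0 f : (0 <= sqnorm f)%E.
Proof. by apply: esum_ge0 => i _; rewrite lee_fin sqr_ge0. Qed.

Lemma square_summableP f :
  reflect (sqnorm f < +oo)%E (f \in square_summable).
Proof. exact: asboolP. Qed.

Lemma normc_ge0 (z : R[i]) : 0 <= normc z.
Proof. by case: z => a b; rewrite /= sqrtr_ge0. Qed.

Lemma sqnorm_le (M : R) (f g : I -> R[i]) : 0 <= M ->
  (forall i, normc (f i) <= M * normc (g i)) ->
  (sqnorm f <= (M ^+ 2)%:E * sqnorm g)%E.
Proof.
move=> M0 fg; rewrite -esumZ ?sqr_ge0//; last first.
  by move=> i; rewrite lee_fin sqr_ge0.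
apply: le_esum => i _; rewrite -EFinM lee_fin -exprMn.
by rewrite ler_pXn2r// nnegrE ?mulr_ge0 ?normc_ge0.
Qed.

Lemma sqnormZ (c : R[i]) (f : I -> R[i]^o) :
  sqnorm (c *: f) = ((normc c ^+ 2)%:E * sqnorm f)%E.
Proof.
rewrite -esumZ ?sqr_ge0//; last by move=> i; rewrite lee_fin sqr_ge0.
apply: eq_esum => i _; rewrite -EFinM -exprMn; congr ((_ ^+ 2)%:E).
exact: normcM.
Qed.

Lemma sqnormD (s : R) (f g : I -> R[i]^o) : 0 < s < 1 ->
  (sqnorm (f + g)%R <= (s^-1)%:E * sqnorm f + ((1 - s)^-1)%:E * sqnorm g)%E.
Proof.
move=> /andP[s0 s1].
have is0 : 0 <= s^-1 by rewrite invr_ge0 ltW.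
have it0 : 0 <= (1 - s)^-1 by rewrite invr_ge0 subr_ge0 ltW.
have sq (h : I -> R[i]) i : (0 <= (normc (h i) ^+ 2)%:E)%E.
  by rewrite lee_fin sqr_ge0.
rewrite -!esumZ// -esumD//; last 2 first.
- by move=> i _; rewrite mule_ge0.
- by move=> i _; rewrite mule_ge0.
apply: le_esum => i _; rewrite -!EFinM -EFinD lee_fin.
set a := normc (f i); set b := normc (g i).
have a0 : 0 <= a := normc_ge0 _; have b0 : 0 <= b := normc_ge0 _.
have ab : normc ((f + g) i) <= a + b := le_normcD _ _.
apply: (@le_trans _ _ ((a + b) ^+ 2)).
  by rewrite ler_pXn2r// nnegrE ?addr_ge0 ?normc_ge0.
rewrite -subr_ge0.
have t0 : 0 < 1 - s by rewrite subr_gt0.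
have -> : s^-1 * a ^+ 2 + (1 - s)^-1 * b ^+ 2 - (a + b) ^+ 2 =
  s^-1 * (1 - s)^-1 * ((1 - s) * a - s * b) ^+ 2.
  by field; rewrite !gt_eqF.
by rewrite mulr_ge0 ?sqr_ge0// mulr_ge0.
Qed.

Lemma square_summable_submod : submod_closed square_summable.
Proof.
split.
  apply/square_summableP; rewrite /sqnorm esum1// => i _.
  by rewrite [normc _]normc0 expr0n.
move=> c f g /square_summableP hf /square_summableP hg; apply/square_summableP.
have h : 0 < (2^-1 : R) < 1 by rewrite invr_gt0 ltr0n invf_lt1 ?ltr1n.
apply: (le_lt_trans (sqnormD _ _ h)); rewrite sqnormZ.
apply: lte_add_pinfty.
  by rewrite !lte_mul_pinfty// ?mule_ge0 ?lee_fin ?sqr_ge0 ?sqnorm_ge0 ?invr_ge0.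
by rewrite lte_mul_pinfty// lee_fin invr_ge0; lra.
Qed.

HB.instance Definition _ :=
  GRing.isSubmodClosed.Build _ _ square_summable square_summable_submod.
HB.instance Definition _ := [SubChoice_isSubLmodule of ell2 by <:].

Lemma ell2_summable (f : ell2) : (sqnorm f < +oo)%E.
Proof. exact/square_summableP/valP. Qed.

Lemma ell2_fin (f : ell2) : sqnorm f \is a fin_num.
Proof. by rewrite ge0_fin_numE ?sqnorm_ge0// ell2_summable. Qed.

Definition rnorm (f : ell2) : R := Num.sqrt (fine (sqnorm f)).

Definition ell2_norm (f : ell2) : R[i] := (rnorm f)%:C.

Lemma rnorm_ge0 f : 0 <= rnorm f. Proof. exact: sqrtr_ge0. Qed.

Lemma sqr_rnorm f : (rnorm f ^+ 2)%:E = sqnorm f.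
Proof. by rewrite sqr_sqrtr ?fine_ge0 ?sqnorm_ge0// fineK// ell2_fin. Qed.

Lemma rnorm0_eq0 f : rnorm f = 0 -> f = 0.
Proof.
move=> f0; have {}f0 : sqnorm f = 0%E by rewrite -sqr_rnorm f0 expr0n.
apply/val_inj/funext => i /=; apply: eq0_normc.
have : ((normc (f i) ^+ 2)%:E <= sqnorm f)%E.
  rewrite -(@esum_set1 _ _ i (fun i => (normc (f i) ^+ 2)%:E)); last first.
    by rewrite lee_fin sqr_ge0.
  rewrite /sqnorm [leLHS]esum_mkcond; apply: le_esum => j _.
  by case: ifP => // _; rewrite lee_fin sqr_ge0.
rewrite f0 lee_fin => h.
by apply/eqP; rewrite -sqrf_eq0 eq_le h sqr_ge0.
Qed.

Lemma ell2_normD f g : ell2_norm (f + g) <= ell2_norm f + ell2_norm g.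
Proof.
rewrite /ell2_norm -rmorphD/= lecR.
have [/eqP|f0] := eqVneq (rnorm f) 0.
  by move=> /eqP/rnorm0_eq0 ->; rewrite add0r lerDr rnorm_ge0.
have [/eqP|g0] := eqVneq (rnorm g) 0.
  by move=> /eqP/rnorm0_eq0 ->; rewrite addr0 lerDl rnorm_ge0.
set a := rnorm f in f0 *; set b := rnorm g in g0 *.
have a0 : 0 < a by rewrite lt0r f0 rnorm_ge0.
have b0 : 0 < b by rewrite lt0r g0 rnorm_ge0.
have ab0 : 0 < a + b by rewrite addr_gt0.
have h : 0 < a / (a + b) < 1.
  by rewrite divr_gt0//= ltr_pdivrMr// mul1r ltrDl.
have := sqnormD f g h.
rewrite -!sqr_rnorm -!EFinM -EFinD -[X in sqnorm X]/(val (f + g)) -sqr_rnorm.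
rewrite lee_fin -/a -/b.
have -> : (a / (a + b))^-1 * a ^+ 2 + (1 - a / (a + b))^-1 * b ^+ 2 =
          (a + b) ^+ 2.
  have -> : 1 - a / (a + b) = b / (a + b) by field; rewrite gt_eqF.
  by field; rewrite !gt_eqF.
by rewrite ler_pXn2r// nnegrE ?rnorm_ge0// ltW.
Qed.

Lemma ell2_normZ (c : R[i]) f : ell2_norm (c *: f) = `|c| * ell2_norm f.
Proof.
rewrite /ell2_norm (_ : `|c| = (normc c)%:C)//.
rewrite -rmorphM/=; congr (_%:C); rewrite /rnorm.
rewrite (_ : sqnorm _ = ((normc c ^+ 2)%:E * sqnorm f)%E); last first.
  exact: sqnormZ.
rewrite fineM ?ell2_fin// sqrtrM ?sqr_ge0//=.
by rewrite sqrtr_sqr ger0_norm ?normc_ge0.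
Qed.

Lemma ell2_norm0_eq0 f : ell2_norm f = 0 -> f = 0.
Proof. by move=> /complexI/rnorm0_eq0. Qed.

HB.instance Definition _ :=
  Lmodule_isNormed.Build R[i] ell2 ell2_normD ell2_normZ ell2_norm0_eq0.

(* Unconditional sum of an absolutely summable family, which is what the product
   of two square-summable families is; the value is irrelevant otherwise. *)
Definition rsum (a : I -> R) : R :=
  fine (\esum_(i in [set: I]) (EFin \o a)^\+ i
        - \esum_(i in [set: I]) (EFin \o a)^\- i).

Definition csum (a : I -> R[i]) : R[i] :=
  rsum (fun i => complex.Re (a i)) +i* rsum (fun i => complex.Im (a i)).

Definition dot (f g : ell2) : R[i] := csum (fun i => (f i)^* * g i).

Lemma delta_subproof (i : I) :
  (fun j => (j == i)%:R : R[i]^o) \in square_summable.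
Proof.
apply/square_summableP.
rewrite /sqnorm (esumID [set i])//; last by move=> j _; rewrite lee_fin sqr_ge0.
rewrite setTI esum_set1 ?lee_fin ?sqr_ge0// esum1 ?adde0 ?ltry//.
by move=> j [_ /eqP/negPf/= ->]; rewrite normc0 expr0n.
Qed.

Definition delta (i : I) : ell2 := Ell2 (delta_subproof i).

Definition finite_combinations : set ell2 :=
  [set f | exists (s : seq I) (c : I -> R[i]), f = \sum_(i <- s) c i *: delta i].

Definition bounded_family T (v : T -> R) := exists M, forall i, `|v i| <= M.

Lemma multiplication_subproof (v : I -> R) (vb : bounded_family v) (f : ell2) :
  (fun i => (v i)%:C * f i : R[i]^o) \in square_summable.
Proof.
have [M hM] := vb; apply/square_summableP.
have M0 : 0 <= `|M| by [].
apply: (@le_lt_trans _ _ ((`|M| ^+ 2)%:E * sqnorm f)%E); last first.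
  by rewrite lte_mul_pinfty ?lee_fin ?sqr_ge0// ell2_summable.
apply: sqnorm_le => // i; rewrite normcM ler_wpM2r ?normc_ge0//=.
by rewrite expr0n/= addr0 sqrtr_sqr (le_trans (hM i))// ler_norm.
Qed.

Definition multiplication (v : I -> R) (vb : bounded_family v) (f : ell2) : ell2 :=
  Ell2 (multiplication_subproof vb f).

Lemma composition_subproof (s : I -> I) (sI : injective s) (f : ell2) :
  (fun i => f (s i)) \in square_summable.
Proof.
apply/square_summableP; apply: le_lt_trans (ell2_summable f).
by apply: (esum_inj sI (a := fun i => (normc (f i) ^+ 2)%:E)) => i;
  rewrite lee_fin sqr_ge0.
Qed.

Definition composition (s : I -> I) (sI : injective s) (f : ell2) : ell2 :=
  Ell2 (composition_subproof sI f).

Lemma ell2P (f g : ell2) : (forall i, f i = g i) -> f = g.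
Proof. by move=> fg; apply/val_inj/funext. Qed.

Lemma ell2DE (f g : ell2) i : (f + g) i = f i + g i. Proof. by []. Qed.

Lemma ell2ZE (c : R[i]) (f : ell2) i : (c *: f) i = c * f i. Proof. by []. Qed.

Lemma ell2_sumE (T : Type) (r : seq T) (P : pred T) (F : T -> ell2) i :
  (\sum_(t <- r | P t) F t : ell2) i = \sum_(t <- r | P t) F t i.
Proof. by apply: (big_morph (fun f : ell2 => f i)). Qed.

End Ell2.

Arguments delta {R I} i.

Section XXZ.
Variables (R : realType) (N : nat).

Definition config := {J : {fset int} | #|` J| == N}.

HB.instance Definition _ := Choice.on config.

Definition transposition (x : int) : int -> int :=
  [eta id with x |-> x + 1, x + 1 |-> x].

Lemma transpositionK x : involutive (transposition x).
Proof.
move=> y; rewrite /transposition /=.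
have x1 : (x + 1 == x) = false by lia.
have [->|yx] := eqVneq y x; first by rewrite eqxx x1.
have [->|yx1] := eqVneq y (x + 1); first by rewrite eqxx.
by rewrite (negPf yx) (negPf yx1).
Qed.

Lemma exchange_subproof x (J : config) :
  #|` [fset transposition x y | y in val J]%fset| == N.
Proof.
by rewrite card_imfset ?(eqP (valP J))//; exact/inv_inj/transpositionK.
Qed.

Definition exchange x (J : config) : config :=
  exist (fun K : {fset int} => #|` K| == N) _ (exchange_subproof x J).

Lemma exchangeK x : involutive (exchange x).
Proof.
move=> J; apply/val_inj/fsetP => y /=.
apply/imfsetP/idP => [[z /= /imfsetP[t /= tJ ->] ->]|yJ].
  by rewrite transpositionK.
exists (transposition x y); last by rewrite transpositionK.
by apply/imfsetP; exists y.
Qed.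

(* The next three operators are given pointwise; the lemmas [spin_exchange_delta],
   [spin_parity_delta] and [number_delta] give their values on basis vectors. *)
Definition spin_exchange x : ell2 R config -> ell2 R config :=
  composition (inv_inj (exchangeK x)).

Definition bond_sign x (J : config) : R :=
  if #|` (val J `&` [fset x; (x + 1)%R])%fset| == 1%N then -1 else 1.

Lemma bond_sign_bounded x : bounded_family (bond_sign x).
Proof. by exists 1 => J; rewrite /bond_sign; case: ifP; rewrite ?normrN normr1. Qed.

Definition spin_parity x : ell2 R config -> ell2 R config :=
  multiplication (bond_sign_bounded x).

Definition occupation x (J : config) : R := (x \in val J)%:R.

Lemma occupation_bounded x : bounded_family (occupation x).
Proof.
by exists 1 => J; rewrite /occupation; case: (_ \in _); rewrite ?normr1 ?normr0.
Qed.

Definition number x : ell2 R config -> ell2 R config :=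
  multiplication (occupation_bounded x).

Lemma spin_exchange_delta x J : spin_exchange x (delta J) = delta (exchange x J).
Proof.
apply/ell2P => K /=.
by rewrite (can2_eq (exchangeK x) (exchangeK x)).
Qed.

Lemma spin_parity_delta x J :
  spin_parity x (delta J) = (bond_sign x J)%:C *: delta J.
Proof.
apply/ell2P => K; rewrite ell2ZE/=.
by have [->|_] := eqVneq K J; rewrite // !mulr0.
Qed.

Lemma number_delta x J : number x (delta J) = (occupation x J)%:C *: delta J.
Proof.
apply/ell2P => K; rewrite ell2ZE/=.
by have [->|_] := eqVneq K J; rewrite // !mulr0.
Qed.

Definition bond (Delta : R) x (f : ell2 R config) : ell2 R config :=
  - ((2 * Delta)^-1)%:C *: (spin_exchange x f - f)
  - (4^-1 * (1 - Delta^-1))%:C *: (spin_parity x f - f).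

(* The big operator over a set is the sum of the non-zero terms provided that
   they are finitely many; see [xxz0_finite] for the domain that matters. *)
Definition xxz0 (Delta : R) (nu : int -> R) (f : ell2 R config) : ell2 R config :=
  \sum_(x \in [set: int]) (bond Delta x f + (nu x)%:C *: number x f).

Lemma transposition_notin x (J : config) :
  x \notin val J -> x + 1 \notin val J -> exchange x J = J.
Proof.
move=> xJ x1J; apply/val_inj/fsetP => y /=.
have tE z : z \in val J -> transposition x z = z.
  move=> zJ; rewrite /transposition /=.
  have /negPf -> : z != x by apply: contraNneq xJ => <-.
  by have /negPf -> : z != x + 1 by apply: contraNneq x1J => <-.
apply/imfsetP/idP => [[z /= zJ ->]|yJ]; first by rewrite tE.
by exists y => //; rewrite tE.
Qed.

Lemma xxz0_finite Delta nu (f : ell2 R config) : finite_combinations f ->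
  finite_set [set x | bond Delta x f + (nu x)%:C *: number x f != 0].
Proof.
move=> [s [c fE]].
have f0 K : K \notin s -> f K = 0.
  move=> Ks; rewrite fE ell2_sumE big_seq big1// => J Js.
  rewrite ell2ZE/=; case: eqVneq => [KJ|]; last by rewrite mulr0.
  by rewrite KJ Js in Ks.
pose B := \big[fsetU/fset0]_(J <- s)
  (val J `|` [fset (y - 1)%R | y in val J])%fset.
apply: (@sub_finite_set _ _ [set` B]); last exact: finite_fset.
move=> x /=; apply: contraR => xB.
have out J : J \in s -> x \notin val J /\ x + 1 \notin val J.
  move=> Js; have {}xB : x \notin (val J `|` [fset (y - 1)%R | y in val J])%fset.
    apply: contra xB; rewrite /B (big_rem J)//= => h.
    by rewrite in_fsetU h.
  move: xB; rewrite in_fsetU negb_or => /andP[-> h]; split=> //.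
  by apply: contra h => h; apply/imfsetP; exists (x + 1) => //=; rewrite addrK.
have e1 : spin_exchange x f = f.
  apply/ell2P => K /=.
  have [Ks|Ks] := boolP (K \in s).
    by have [a b] := out _ Ks; rewrite transposition_notin.
  have [Es|Es] := boolP (exchange x K \in s); last by rewrite !f0.
  have [a b] := out _ Es.
  by have := transposition_notin a b; rewrite exchangeK => <-.
have e2 : spin_parity x f = f.
  apply/ell2P => K /=.
  have [Ks|Ks] := boolP (K \in s); last by rewrite f0// mulr0.
  have [a b] := out _ Ks; rewrite /bond_sign.
  rewrite (_ : (_ `&` _)%fset = fset0) ?cardfs0 ?mul1r//.
  apply/fsetP => y; rewrite !inE; apply/negbTE/negP => /andP[yK].
  by case/orP => /eqP yE; [move: a|move: b]; rewrite -yE yK.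
have e3 : number x f = 0.
  apply/ell2P => K /=.
  have [Ks|Ks] := boolP (K \in s); last by rewrite f0// mulr0.
  by have [/negPf a _] := out _ Ks; rewrite /occupation a mul0r.
by rewrite /bond e1 e2 e3 !subrr !scaler0 subrr addr0.
Qed.

(* The operator closure of [xxz0] restricted to [finite_combinations], as a graph:
   the closure, in the product norm topology, of the graph of the restriction. *)
Definition xxz_graph (Delta : R) (nu : int -> R) :
    set (ell2 R config * ell2 R config)%type :=
  closure [set (f, xxz0 Delta nu f) | f in @finite_combinations R config].

End XXZ.

Section Schrodinger.
Variables (R : realType) (N : nat).

Notation sites := {ffun 'I_N -> int}.

Definition update (x : sites) (j : 'I_N) (y : int) : sites :=
  [ffun k => if k == j then y else x k].

Definition permute (s : 'S_N) (x : sites) : sites := [ffun i => x (s i)].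

Definition h0 (u : int -> R[i]) (x : int) : R[i] := u (x - 1) + u (x + 1).

Lemma update_inj (j : 'I_N) (a : int) :
  injective (fun x : sites => update x j (x j + a)).
Proof.
move=> x y /ffunP xy; apply/ffunP => k; have := xy k; rewrite !ffunE.
by case: eqVneq => [-> /addIr|].
Qed.

Lemma hop_subproof (j : 'I_N) (f : ell2 R sites) :
  (fun x => h0 (fun y => f (update x j y)) (x j) : R[i]^o)
    \in @square_summable R sites.
Proof.
exact: (valP (composition (@update_inj j (- 1)) f
            + composition (@update_inj j 1) f)).
Qed.

Definition hop (j : 'I_N) (f : ell2 R sites) : ell2 R sites :=
  Ell2 (hop_subproof j f).

Definition potential (nu : int -> R) (x : sites) : R := \sum_(j < N) nu (x j).

Definition pairQ (r : nat) : R := if r == 1%N then -1 else 0.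

Definition interaction (x : sites) : R :=
  \sum_(k < N) \sum_(l < N | (k < l)%N) pairQ `|x k - x l|%N.

Lemma potential_bounded nu : bounded_family nu -> bounded_family (potential nu).
Proof.
move=> [M nuM]; exists (\sum_(j < N) M) => x.
by rewrite (le_trans (ler_norm_sum _ _ _))// ler_sum.
Qed.

Lemma interaction_bounded : bounded_family interaction.
Proof.
exists (\sum_(k < N) \sum_(l < N | (k < l)%N) 1) => x.
rewrite (le_trans (ler_norm_sum _ _ _))// ler_sum// => k _.
rewrite (le_trans (ler_norm_sum _ _ _))// ler_sum// => l _.
by rewrite /pairQ; case: ifP; rewrite ?normrN ?normr1 ?normr0.
Qed.

Definition schrodinger (Delta : R) (nu : int -> R) (nub : bounded_family nu)
    (f : ell2 R sites) : ell2 R sites :=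
  - ((2 * Delta)^-1)%:C *: \sum_(j < N) hop j f
  + multiplication (potential_bounded nub) f
  + multiplication interaction_bounded f.

Definition antisymmetric_pred : {pred ell2 R sites} :=
  fun f => `[< forall (s : 'S_N) x, f (permute s x) = (-1) ^+ s * f x >].

Lemma antisymmetricP (f : ell2 R sites) :
  reflect (forall (s : 'S_N) x, f (permute s x) = (-1) ^+ s * f x)
          (f \in antisymmetric_pred).
Proof. exact: asboolP. Qed.

Record ell2a := Ell2a { ell2a_val :> ell2 R sites ;
                        _ : ell2a_val \in antisymmetric_pred }.

HB.instance Definition _ := [isSub for ell2a_val].
HB.instance Definition _ := [Choice of ell2a by <:].

Lemma antisymmetric_submod : submod_closed antisymmetric_pred.
Proof.
split; first by apply/antisymmetricP => s x; rewrite mulr0.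
move=> c f g /antisymmetricP hf /antisymmetricP hg; apply/antisymmetricP => s x.
rewrite [LHS]/(c * f (permute s x) + g (permute s x)) hf hg.
by rewrite [X in _ = _ * X]/(c * f x + g x) mulrDr mulrCA.
Qed.

HB.instance Definition _ :=
  GRing.isSubmodClosed.Build _ _ antisymmetric_pred antisymmetric_submod.
HB.instance Definition _ := [SubChoice_isSubLmodule of ell2a by <:].

Lemma potential_permute nu s x : potential nu (permute s x) = potential nu x.
Proof.
rewrite /potential [RHS](reindex_inj (@perm_inj _ s))/=.
by apply: eq_bigr => j _; rewrite ffunE.
Qed.

Lemma interaction2 x :
  interaction x *+ 2 = \sum_(k < N) \sum_(l < N | l != k) pairQ `|x k - x l|%N.
Proof.
rewrite mulr2n {2}/interaction (exchange_big_dep xpredT)//= -big_split/=.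
apply: eq_bigr => k _; rewrite [RHS](bigID (fun l : 'I_N => (k < l)%N))/=.
congr (_ + _).
  by apply: eq_bigl => l; rewrite -val_eqE/= neq_ltn; case: ltngtP.
apply: eq_big => [l|l _]; last by rewrite distnC.
by rewrite -val_eqE/= neq_ltn; case: ltngtP.
Qed.

Lemma interaction_permute s x : interaction (permute s x) = interaction x.
Proof.
apply: (@mulIf _ 2%:R); first by rewrite pnatr_eq0.
rewrite !mulr_natr !interaction2 [RHS](reindex_inj (@perm_inj _ s))/=.
apply: eq_bigr => k _; rewrite [RHS](reindex_inj (@perm_inj _ s))/=.
by apply: eq_big => [l|l _]; rewrite ?(inj_eq perm_inj)// !ffunE.
Qed.

Lemma hop_permute (j : 'I_N) (f : ell2a) (s : 'S_N) x :
  hop j f (permute s x) = (-1) ^+ s * hop (s j) f x.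
Proof.
have fs := antisymmetricP _ (valP f).
have e y : update (permute s x) j y = permute s (update x (s j) y).
  by apply/ffunP => k; rewrite !ffunE (inj_eq perm_inj).
by rewrite /= /h0 !e !fs ffunE mulrDr.
Qed.

Lemma schrodinger_antisymmetric Delta nu (nub : bounded_family nu) (f : ell2a) :
  schrodinger Delta nub f \in antisymmetric_pred.
Proof.
have fs := antisymmetricP _ (valP f).
apply/antisymmetricP => s x.
rewrite [LHS]/(- ((2 * Delta)^-1)%:C * (\sum_(j < N) hop j f : ell2 R sites) (permute s x)
  + (potential nu (permute s x))%:C * f (permute s x)
  + (interaction (permute s x))%:C * f (permute s x)).
rewrite [X in _ = _ * X]/(- ((2 * Delta)^-1)%:C * (\sum_(j < N) hop j f : ell2 R sites) x
  + (potential nu x)%:C * f x + (interaction x)%:C * f x).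
rewrite potential_permute interaction_permute fs !mulrDr.
congr (_ + _ + _); [|exact: mulrCA..].
rewrite !ell2_sumE mulrCA; congr (_ * _).
rewrite mulr_sumr (eq_bigr _ (fun j _ => hop_permute j f s x)).
by rewrite [RHS](reindex_inj (@perm_inj _ s)).
Qed.

Definition schrodinger_a (Delta : R) (nu : int -> R) (nub : bounded_family nu)
    (f : ell2a) : ell2a :=
  Ell2a (schrodinger_antisymmetric Delta nub f).

(* The tensor product of basis vectors [e_(y 1) (x) ... (x) e_(y N)] is the
   basis vector [delta y] of [\ell^2(Z^N)]. *)
Lemma delta_prod (y x : sites) :
  (delta y : ell2 R sites) x = \prod_(j < N) (delta (y j) : ell2 R int) (x j).
Proof.
rewrite /=; have [->|xy] := eqVneq x y; first by rewrite big1// => j _; rewrite eqxx.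
have [j xyj] : exists j, x j != y j.
  by apply/existsP; apply: contraR xy => /existsPn h; apply/eqP/ffunP => j;
    apply/eqP/negbNE/h.
by rewrite (bigD1 j)//= (negPf xyj) mul0r.
Qed.

Definition slater (x : sites) : ell2 R sites :=
  ((Num.sqrt (N`!%:R : R))^-1)%:C *:
    \sum_(s : 'S_N) (-1) ^+ s *: delta (permute s x).

(* [slater] takes values in [ell2 R sites], hence [val] in the last field. *)
Record is_canonical_unitary (U : ell2 R (config N) -> ell2a) : Prop := {
  U_linear : linear U ;
  U_bijective : bijective U ;
  U_isometric : forall f g, dot (U f) (U g) = dot f g ;
  U_basis : forall (x : sites) (J : config N),
    (forall k l : 'I_N, (k < l)%N -> x k < x l) ->
    val J = [fset x k | k in 'I_N]%fset ->
    val (U (delta J)) = slater x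
}.

End Schrodinger.

Definition graph (S T : Type) (A : S -> T) : set (S * T)%type :=
  [set (f, A f) | f in [set: S]].

(* Main.v *)
(**
U sends a function f of configurations to the antisymmetric function whose value
at an ordered tuple x_1 < ... < x_N is f({x_1,...,x_N}) / sqrt(N!). At such a
tuple the hop of one particle onto an occupied site contributes 0, because an
antisymmetric function vanishes when two coordinates coincide, while a hop onto
an empty site preserves the order and is the exchange of two neighbouring spins.
On the diagonal, every bond with exactly one down-spin contributes 1/2 to the XXZ
Hamiltonian, and there are 2(N + W) such bonds: of the 2N (particle, adjacent
bond) pairs, two are lost for each of the -W pairs of neighbouring particles.
Hence the two operators agree on finite combinations; these are dense and the
conjugated Schrödinger operator is bounded, so the closure of the XXZ graph is
its full graph.
*)

Require Import Defs.
From mathcomp Require Import all_boot all_order all_algebra.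
From mathcomp Require Import perm finmap.
From mathcomp Require Import all_classical all_reals all_analysis.
From mathcomp Require Import complex.
From mathcomp Require Import ring lra zify.

Set Implicit Arguments.
Unset Strict Implicit.
Unset Printing Implicit Defensive.

Import Order.TTheory GRing.Theory Num.Theory.
Import numFieldNormedType.Exports Normc.

Local Open Scope classical_set_scope.
Local Open Scope ring_scope.
Local Open Scope complex_scope.

(** * Norm estimates, density of finite combinations, and closures of graphs *)

Section Norm.
Variable R : realType.

Lemma csum_point (I : choiceType) (a : I -> R[i]) i :
  (forall j, j != i -> a j = 0) -> csum a = a i.
Proof.
have rsum_point (b : I -> R) : (forall j, j != i -> b j = 0) -> rsum b = b i.
  move=> b0; rewrite /rsum.
  have pt (d : I -> \bar R) : (forall j, 0 <= d j)%E ->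
      (forall j, j != i -> d j = 0%E) -> (\esum_(j in [set: I]) d j = d i)%E.
    move=> d0 di; rewrite -(esum_set1 (t := i) (a := d))// [RHS]esum_mkcond.
    apply: eq_esum => j _; case: ifPn => //; rewrite notin_setE/= => /eqP.
    exact: di.
  rewrite (pt (EFin \o b)^\+)%E// ?(pt (EFin \o b)^\-)%E//.
  - by have /(congr1 (@^~ i))/= <- := funeposneg (EFin \o b).
  - by move=> j ji; rewrite funenegE/= b0// oppr0 maxxx.
  - by move=> j ji; rewrite funeposE/= b0// maxxx.
move=> a0; rewrite /csum !rsum_point; first by case: (a i).
- by move=> j /a0 ->.
- by move=> j /a0 ->.
Qed.

(** Lets the uniqueness of the unitary be checked coefficient by coefficient. *)
Lemma dot_delta (I : choiceType) (i : I) (f : ell2 R I) : dot (delta i) f = f i.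
Proof.
rewrite /dot (csum_point (i := i)) => [|j ji] /=; first by rewrite eqxx conjC1 mul1r.
by rewrite (negPf ji) conjC0 mul0r.
Qed.

Lemma rnorm_le (I K : choiceType) (M : R) (f : ell2 R I) (g : ell2 R K) : 0 <= M ->
  (sqnorm f <= (M ^+ 2)%:E * sqnorm g)%E -> rnorm f <= M * rnorm g.
Proof.
move=> M0; rewrite -!sqr_rnorm -EFinM lee_fin -exprMn ler_pXn2r//.
  by rewrite nnegrE rnorm_ge0.
by rewrite nnegrE mulr_ge0 ?rnorm_ge0.
Qed.

Lemma rnormD (I : choiceType) (f g : ell2 R I) : rnorm (f + g) <= rnorm f + rnorm g.
Proof. by have := ell2_normD f g; rewrite /ell2_norm -rmorphD/= lecR. Qed.

Lemma rnormZ (I : choiceType) (a : R[i]) (f : ell2 R I) :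
  rnorm (a *: f) = normc a * rnorm f.
Proof. by have := ell2_normZ a f; rewrite /ell2_norm -rmorphM/= => /complexI. Qed.

Lemma rnorm_multiplication (I : choiceType) (v : I -> R) (vb : bounded_family v) :
  exists2 M, 0 <= M & forall f, rnorm (multiplication vb f) <= M * rnorm f.
Proof.
have [M vM] := vb; exists `|M| => // f; apply: rnorm_le => //.
apply: sqnorm_le => // i /=; rewrite normcM ler_wpM2r ?normc_ge0//=.
by rewrite expr0n/= addr0 sqrtr_sqr (le_trans (vM i))// ler_norm.
Qed.

Lemma rnorm_composition (I : choiceType) (s : I -> I) (sI : injective s) (f : ell2 R I) :
  rnorm (composition sI f) <= rnorm f.
Proof.
rewrite -[leRHS]mul1r; apply: rnorm_le => //; rewrite expr1n mul1e.
by apply: (esum_inj sI (a := fun i => (normc (f i) ^+ 2)%:E)) => i;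
  rewrite lee_fin sqr_ge0.
Qed.

Lemma deltaE (I : choiceType) (i j : I) : (delta i : ell2 R I) j = (j == i)%:R.
Proof. by []. Qed.

(** The squared norm is the supremum of the sums over finite index sets. Cutting [f] down to a
    finite set [A] whose sum is within [e ^+ 2] of it leaves a tail of squared norm below
    [e ^+ 2]. *)
Lemma finite_combinations_dense (I : choiceType) (f : ell2 R I) (e : R) : 0 < e ->
  exists2 d, finite_combinations d & rnorm (f - d) < e.
Proof.
move=> e0; have e20 : 0 < e ^+ 2 by rewrite exprn_gt0.
have f0 i : (0 <= (normc (f i) ^+ 2)%:E)%E by rewrite lee_fin sqr_ge0.
have [_ [A [finA _] <-] fA] := ub_ereal_sup_adherent e20 (ell2_fin f).
pose d : ell2 R I := \sum_(i <- fset_set A) f i *: delta i.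
have dE i : d i = if i \in A then f i else 0.
  rewrite /d ell2_sumE; case: ifPn => iA.
    rewrite (big_fsetD1 i) ?in_fset_set// ell2ZE deltaE eqxx mulr1.
    rewrite big1_seq ?[LHS]addr0// => j.
    by rewrite !inE => /and3P[_ /negPf ji _]; rewrite ell2ZE deltaE eq_sym ji mulr0.
  rewrite big1_seq// => j /andP[_ ]; rewrite in_fset_set// => jA.
  rewrite ell2ZE deltaE; case: eqVneq => [ij|]; last by rewrite mulr0.
  by rewrite ij jA in iA.
exists d; first by exists (fset_set A), f.
suff : (sqnorm (f - d)%R < (e ^+ 2)%:E)%E.
  by rewrite -sqr_rnorm lte_fin ltr_pXn2r// nnegrE ?rnorm_ge0// ltW.
have -> : sqnorm (f - d) = (\esum_(i in ~` A) (normc (f i) ^+ 2)%:E)%E.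
  rewrite /sqnorm [RHS]esum_mkcond; apply: eq_esum => i _.
  transitivity (normc (f i - d i) ^+ 2)%:E => //; rewrite dE in_setC.
  by case: (i \in A); rewrite /= ?subr0// subrr [normc _]normc0 expr0n.
move: fA; rewrite -[ereal_sup _]/(sqnorm f) /sqnorm (esumID A)// !setTI.
rewrite (esum_fset finA)//.
have : (\sum_(i \in A) (normc (f i) ^+ 2)%:E)%E \is a fin_num.
  by rewrite fsbig_finite// sumEFin.
move: (\sum_(i \in A) _)%E => [a| |]// _.
move: (\esum_(i in _) _)%E => [b| |]//; last by move=> _; rewrite ltNyr.
by rewrite -EFinD !lte_fin; lra.
Qed.

(* Over [R[i]] the norm is complex-valued, whence the passage through [%:C]. *)
Lemma ball_rnorm (I : choiceType) (f g : ell2 R I) (e : R) :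
  ball f e%:C g = (rnorm (f - g) < e) :> Prop.
Proof.
by rewrite -ball_normE /ball_/= -[ `|_| ]/((rnorm (f - g))%:C) ltcR.
Qed.

Lemma nbhs_rnorm (I : choiceType) (f : ell2 R I) (A : set (ell2 R I)) : nbhs f A ->
  exists2 e : R, 0 < e & forall g, rnorm (f - g) < e -> A g.
Proof.
move/nbhs_ballP => [[e b] /=]; rewrite ltcE/= => /andP[/eqP -> e0] fA.
by exists e => // g fg; apply: fA; have : ball f e%:C g by rewrite ball_rnorm.
Qed.

(** A Lipschitz map has a closed graph, and by density of the finite combinations every point of
    that graph is a limit of points above them. *)
Lemma closure_graph (I K : choiceType) (T : ell2 R I -> ell2 R K) (M : R) : 0 <= M ->
  (forall f g, rnorm (T f - T g) <= M * rnorm (f - g)) ->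
  closure [set (f, T f) | f in @finite_combinations R I] = graph T.
Proof.
move=> M0 TM; have M10 : 0 < 1 + M by rewrite ltr_pwDl.
apply/seteqP; split=> [[f g] fg|_ [f _ <-] B [[P Q]/= [fP fQ] PQ]].
  exists f => //; congr pair; apply/eqP; rewrite -subr_eq0; apply/eqP/rnorm0_eq0/eqP.
  apply: contraT => r0; have {}r0 : 0 < rnorm (T f - g) by rewrite lt0r r0 rnorm_ge0.
  (* With this radius, a point [(d, T d)] near [(f, g)] would make the norm of [T f - g] smaller
     than [(1 + M) * e], which is that norm itself. *)
  have e0 : 0 < rnorm (T f - g) / (1 + M) by rewrite divr_gt0.
  set e := _ / _ in e0.
  have /fg[_ [[d _ <-] [/= fd gd]]] : nbhs (f, g) (ball f e%:C `*` ball g e%:C).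
    by exists (ball f e%:C, ball g e%:C) => //=; split; apply: nbhsx_ballx; rewrite ltcR.
  rewrite !ball_rnorm in fd gd.
  have : rnorm (T f - g) < (1 + M) * e.
    have -> : T f - g = (T f - T d) + - 1 *: (g - T d).
      by rewrite scaleN1r opprB addrA subrK.
    apply: le_lt_trans (rnormD _ _) _.
    rewrite rnormZ normcN normc1 mul1r mulrDl mul1r addrC ltr_leD//.
    by apply: le_trans (TM _ _) _; rewrite ler_wpM2l// ltW.
  by rewrite /e mulrC divfK ?ltxx// gt_eqF.
have [e e0 eP] := nbhs_rnorm fP; have [e' e0' eQ] := nbhs_rnorm fQ.
(* Dividing by [1 + M] brings [T d] within [e'] of [T f] and is legitimate even for [M = 0]. *)
have [|d dfc dlt] := finite_combinations_dense f (e := Num.min e (e' / (1 + M))).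
  by rewrite lt_min e0 divr_gt0.
move: dlt; rewrite lt_min ltr_pdivlMr// => /andP[de de'].
exists (d, T d); split; first by exists d.
apply: PQ; split; [exact: eP|apply: eQ] => /=.
apply: le_lt_trans (TM _ _) (le_lt_trans _ de').
by rewrite mulrC ler_wpM2l ?rnorm_ge0// lerDr.
Qed.

End Norm.

(** * Tuples of sites, their orientation, and the configurations they occupy *)

Section Configurations.
Variable N : nat.

Notation sites := {ffun 'I_N -> int}.

(* The sign of the permutation sorting [x], and 0 if two coordinates coincide:
   [det_Vandermonde] is the product of the [x l - x k] over [k < l]. *)
Definition orientation (x : sites) : int :=
  Num.sg (\det (Vandermonde N (\row_k x k))).

(** Permuting the coordinates permutes the columns of the Vandermonde matrix, which multiplies its
    determinant by the sign. *)
Lemma orientation_permute (s : 'S_N) x :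
  orientation (permute s x) = (-1) ^+ s * orientation x.
Proof.
rewrite /orientation.
have -> : Vandermonde N (\row_k permute s x k) =
    col_perm s (Vandermonde N (\row_k x k)).
  by apply/matrixP => i j; rewrite !mxE ffunE.
rewrite col_permE det_mulmx det_perm odd_permV sgrM mulrC; congr (_ * _).
by case: (s : bool); rewrite ?expr1 ?expr0 ?sgrN1 ?sgr1.
Qed.

(** The transposition of [i] and [j] fixes [x] and yet changes the sign of [g x]. *)
Lemma antisymmetric_eq0 (K : numDomainType) (g : sites -> K) x i j :
  (forall s : 'S_N, g (permute s x) = (-1) ^+ s * g x) ->
  i != j -> x i = x j -> g x = 0.
Proof.
move=> gs ij xij; have := gs (tperm i j).
rewrite odd_tperm ij expr1 mulN1r (_ : permute _ x = x).
  by move/eqP; rewrite -subr_eq0 opprK -mulr2n mulrn_eq0/= => /eqP.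
by apply/ffunP => k; rewrite ffunE; case: tpermP => [->|->|].
Qed.

Lemma permute_inj (x : sites) : injective x -> injective (fun s : 'S_N => permute s x).
Proof.
move=> xI s t /ffunP st; apply/permP => k.
by have := st k; rewrite !ffunE => /xI.
Qed.

Definition increasing (x : sites) := forall k l : 'I_N, (k < l)%N -> x k < x l.

Lemma increasing_injective x : increasing x -> injective x.
Proof.
move=> xi k l; apply: contra_eq => kl; apply/eqP => xkl.
have := xi k l; have := xi l k; rewrite xkl ltxx; move: kl; rewrite -val_eqE/=.
by case: ltngtP => // _ _; [move=> /(_ isT)|move=> _ /(_ isT)].
Qed.

Lemma orientation_increasing x : increasing x -> orientation x = 1.
Proof.
move=> xi; rewrite /orientation det_Vandermonde gtr0_sg//.
by apply: prodr_gt0 => k _; apply: prodr_gt0 => l kl; rewrite !mxE subr_gt0 xi.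
Qed.

Definition image_set (x : sites) : {fset int} := [fset x k | k in 'I_N]%fset.

Lemma image_setP (x : sites) y : reflect (exists k, y = x k) (y \in image_set x).
Proof.
by apply: (iffP (imfsetP _ _ _ _)) => [[k _ ->]|[k ->]]; exists k.
Qed.

Lemma image_set_permute (s : 'S_N) x : image_set (permute s x) = image_set x.
Proof.
apply/fsetP => y; apply/image_setP/image_setP => [[k ->]|[k ->]].
  by exists (s k); rewrite ffunE.
by exists (s^-1 k)%g; rewrite ffunE permKV.
Qed.

(** The value is [None] exactly when two coordinates coincide, since the image then has fewer than N
    elements. *)
Definition config_of (x : sites) : option (config N) := insub (image_set x).

Lemma config_of_permute (s : 'S_N) x : config_of (permute s x) = config_of x.
Proof. by rewrite /config_of image_set_permute. Qed.

(** The increasing enumeration of [J]. The default 0 of [nth] is never reached, because the sorted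
    list has length N. *)
Definition config_sites (J : config N) : sites :=
  [ffun k : 'I_N => nth 0 (sort <=%O (enum_fset (val J))) k].

Let size_config_sort (J : config N) : size (sort <=%O (enum_fset (val J))) = N.
Proof. by rewrite size_sort; exact/eqP/(valP J). Qed.

Lemma config_sites_increasing J : increasing (config_sites J).
Proof.
move=> k l kl; rewrite !ffunE lt_sorted_ltn_nth//.
- by rewrite sort_lt_sorted fset_uniq.
- by rewrite inE/= size_config_sort.
- by rewrite inE/= size_config_sort.
Qed.

Lemma image_config_sites J : image_set (config_sites J) = val J.
Proof.
have memJ y : (y \in sort <=%O (enum_fset (val J))) = (y \in val J).
  by rewrite mem_sort.
apply/fsetP => y; rewrite -memJ; apply/image_setP/idP => [[k ->]|yJ].
  by rewrite ffunE mem_nth// size_config_sort.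
have yN : (index y (sort <=%O (enum_fset (val J))) < N)%N.
  by rewrite -[X in (_ < X)%N](size_config_sort J) index_mem.
by exists (Ordinal yN); rewrite ffunE /= nth_index.
Qed.

Lemma config_sitesK J : config_of (config_sites J) = Some J.
Proof. by rewrite /config_of image_config_sites; exact: valK. Qed.

(** Send [k] to a position in [x] of the value [y k]. Since [y] is injective, so is this map; hence
    it is a permutation, and its inverse is the one sought. *)
Lemma permute_of_image (x y : sites) : injective y -> image_set x = image_set y ->
  exists s : 'S_N, x = permute s y.
Proof.
move=> yI xy.
have ex k : exists l, y k == x l.
  have /image_setP[l ->] : y k \in image_set x by rewrite xy; apply/image_setP; exists k.
  by exists l.
pose p k := xchoose (ex k).
have pE k : y k = x (p k) := eqP (xchooseP (ex k)).
have pI : injective p by move=> k l kl; apply: yI; rewrite !pE kl.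
exists (perm pI)^-1%g; apply/ffunP => k.
by rewrite ffunE pE -[p _](permE pI) permKV.
Qed.

(** The dichotomy behind all evaluations at tuples: a rearranged increasing enumeration, or a
    coincidence at which antisymmetric functions vanish. *)
Variant sites_spec (x : sites) : option (config N) -> Prop :=
  | SitesConfig J (s : 'S_N) of x = permute s (config_sites J) :
      sites_spec x (Some J)
  | SitesCoincide k l of k != l & x k = x l : sites_spec x None.

Lemma sitesP x : sites_spec x (config_of x).
Proof.
rewrite /config_of; case: insubP => [J _ /= xJ|].
  have [s xs] : exists s : 'S_N, x = permute s (config_sites J).
    apply: permute_of_image; last by rewrite image_config_sites.
    exact/increasing_injective/config_sites_increasing.
  exact: SitesConfig xs.
move=> cx; have /injectivePn[k [l kl xkl]] : ~~ injectiveb x.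
  apply: contra cx => /injectiveP xI.
  by rewrite card_imfset//= -cardE card_ord.
exact: SitesCoincide kl xkl.
Qed.

End Configurations.

(** * Antisymmetric extension of functions of configurations to tuples *)

Section SlaterSum.
Variables (R : realType) (N : nat).

Notation sites := {ffun 'I_N -> int}.

(* Each configuration is the set of values of exactly N! tuples. *)
Lemma esum_sites (b : config N -> \bar R) : (forall J, 0 <= b J)%E ->
  (\esum_(x in [set: sites])
     oapp (fun J => (N`!%:R^-1)%:E * b J) 0 (config_of x) =
   \esum_(J in [set: config N]) b J)%E.
Proof.
move=> b0; set c := N`!%:R^-1 : R.
have c0 : 0 <= c by rewrite invr_ge0.
pose e (k : config N * 'S_N) := permute k.2 (config_sites k.1).
have eI : injective e.
  move=> [J s] [K t] est; move: (congr1 (@config_of N) est).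
  rewrite /e !config_of_permute !config_sitesK => -[JK]; move: est; rewrite /e JK/=.
  by move/(permute_inj (increasing_injective (config_sites_increasing K))) ->.
(* Tuples outside the image of [e] have two equal coordinates and contribute 0. *)
transitivity (\esum_(x in [set e k | k in [set: config N * 'S_N]])
    oapp (fun J => c%:E * b J) 0 (config_of x))%E.
  rewrite [RHS]esum_mkcond; apply: eq_esum => x _; case: ifPn => //.
  rewrite notin_setE/=; case: sitesP => [J s ->|//] []; by exists (J, s).
rewrite esum_image; last by move=> ? ? _ _ /eI.
have -> : [set: config N * 'S_N] = ([set: config N] `*`` (fun=> [set: 'S_N]))%classic.
  by apply/seteqP; split.
rewrite (eq_esum (b := fun k : config N * 'S_N => c%:E * b k.1)%E); last first.
  by move=> k _; rewrite /e config_of_permute config_sitesK.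
rewrite -(@esum_esum _ _ _ _ (fun=> setT) (fun J _ => c%:E * b J)%E); last first.
  by move=> J s _ _; rewrite mule_ge0.
apply: eq_esum => J _; rewrite esum_fset//; last 2 first.
- exact: finite_finset.
- by move=> s _; rewrite mule_ge0.
rewrite (@fsbigE _ _ _ _ _ (enum 'S_N)) ?enum_uniq//; last first.
  by move=> s _; rewrite mem_enum.
rewrite (eq_bigl xpredT); last by move=> s; rewrite in_setT.
rewrite big_enum/= -ge0_sume_distrl ?sumEFin ?sumr_const//.
rewrite (_ : #|_| = N`!) ?card_Sn// -mulr_natr mulVf ?mul1e//.
Qed.

(** [rsum] is a difference of two sums of non-negative terms. The factor 1/N! is non-negative, so it
    commutes with taking positive and negative parts, and [esum_sites] applies to each. *)
Lemma rsum_sites (a : config N -> R) :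
  rsum (fun x : sites => oapp (fun J => N`!%:R^-1 * a J) 0 (config_of x)) = rsum a.
Proof.
have c0 : (0 : R) <= N`!%:R^-1 by rewrite invr_ge0.
rewrite /rsum; congr (fine (_ - _)).
  rewrite -(@esum_sites (EFin \o a)^\+)%E//; apply: eq_esum => x _.
  rewrite funeposE/=; case: (config_of x) => [J|]/=; last by rewrite maxxx.
  by rewrite funeposE EFinM maxe_pMr// mule0.
rewrite -(@esum_sites (EFin \o a)^\-)%E//; apply: eq_esum => x _.
rewrite funenegE/=; case: (config_of x) => [J|]/=; last by rewrite oppr0 maxxx.
by rewrite funenegE EFinN EFinM -muleN maxe_pMr// mule0.
Qed.

Lemma csum_sites (a : config N -> R[i]) :
  csum (fun x : sites => oapp (fun J => (N`!%:R^-1)%:C * a J) 0 (config_of x)) =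
  csum a.
Proof.
rewrite /csum -(rsum_sites (fun J => complex.Re (a J))).
rewrite -(rsum_sites (fun J => complex.Im (a J))).
congr Complex; congr rsum; apply/funext => x; case: (config_of x) => //= J.
  by case: (a J) => u v /=; rewrite mul0r subr0.
by case: (a J) => u v /=; rewrite mul0r addr0.
Qed.

Definition slater_norm : R := (Num.sqrt (N`!%:R : R))^-1.

Lemma slater_norm_gt0 : 0 < slater_norm.
Proof. by rewrite invr_gt0 sqrtr_gt0 ltr0n fact_gt0. Qed.

Lemma slater_norm_sqr : slater_norm ^+ 2 = N`!%:R^-1.
Proof. by rewrite exprVn sqr_sqrtr. Qed.

(** The pointwise formula for U. The orientation makes it antisymmetric, and the default 0 at
    coinciding coordinates is forced by antisymmetry. *)
Definition slater_sum (f : config N -> R[i]) (x : sites) : R[i] :=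
  oapp (fun J => slater_norm%:C * (orientation x)%:~R * f J) 0 (config_of x).

Lemma slater_sum_permute (s : 'S_N) f x :
  slater_sum f (permute s x) = (-1) ^+ s * slater_sum f x.
Proof.
rewrite /slater_sum config_of_permute; case: (config_of x) => [J|]/=.
  by rewrite orientation_permute intrM rmorph_sign mulrCA -!mulrA.
by rewrite mulr0.
Qed.

Lemma slater_sum_config f J :
  slater_sum f (config_sites J) = slater_norm%:C * f J.
Proof.
rewrite /slater_sum config_sitesK/= orientation_increasing ?mulr1//.
exact: config_sites_increasing.
Qed.

(** An antisymmetric function is determined by its values at increasing tuples: both sides acquire
    the same sign under rearrangement and vanish at coincidences. *)
Lemma slater_sumK (g : sites -> R[i]) :
  (forall (s : 'S_N) x, g (permute s x) = (-1) ^+ s * g x) ->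
  slater_sum (fun J => slater_norm^-1%:C * g (config_sites J)) = g.
Proof.
move=> gs; apply/funext => x.
rewrite [in LHS]/slater_sum; case: sitesP => [J s xJ|k l kl xkl]/=; last first.
  by rewrite (antisymmetric_eq0 (gs^~ x) kl xkl).
rewrite xJ gs orientation_permute orientation_increasing; last first.
  exact: config_sites_increasing.
rewrite mulr1 rmorph_sign mulrACA -rmorphM/= divff ?mul1r//.
by rewrite gt_eqF// slater_norm_gt0.
Qed.

Lemma orientation_sqr (x : sites) J : config_of x = Some J -> orientation x ^+ 2 = 1.
Proof.
case: sitesP => // K s -> _; rewrite orientation_permute orientation_increasing.
  by rewrite mulr1 sqrr_sign.
exact: config_sites_increasing.
Qed.

(** Each value of [f] is spread over N! tuples, with weight 1/N! in the squared modulus because the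
    orientation there is a sign. *)
Lemma sqnorm_slater_sum (f : config N -> R[i]) : sqnorm (slater_sum f) = sqnorm f.
Proof.
rewrite /sqnorm -esum_sites; last by move=> J; rewrite lee_fin sqr_ge0.
apply: eq_esum => x _; rewrite /slater_sum.
case E : (config_of x) => [J|]; last by rewrite [normc _]normc0 expr0n.
transitivity (normc (slater_norm%:C * (orientation x)%:~R * f J) ^+ 2)%:E => //.
transitivity (N`!%:R^-1 * normc (f J) ^+ 2)%:E => //; congr (_%:E).
rewrite -slater_norm_sqr !normcM !exprMn.
rewrite [normc (_%:~R)](_ : _ = 1) ?expr1n ?mulr1; last first.
  have := orientation_sqr E; case: sitesP E => // K s -> _.
  rewrite orientation_permute orientation_increasing; last first.
    exact: config_sites_increasing.
  by rewrite mulr1 rmorph_sign => _; case: (s : bool); rewrite ?normcN ?normc1.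
by rewrite /= expr0n addr0 sqr_sqrtr ?sqr_ge0.
Qed.

End SlaterSum.

(** * The canonical unitary, its inverse, and its uniqueness *)

Section Unitary.
Variables (R : realType) (N : nat).

Notation sites := {ffun 'I_N -> int}.
Notation Hxxz := (ell2 R (config N)).
Notation c := (slater_norm R N).

Lemma slater_sum_summable (f : Hxxz) :
  (slater_sum f : sites -> R[i]^o) \in @square_summable R _.
Proof. by apply/square_summableP; rewrite sqnorm_slater_sum ell2_summable. Qed.

Lemma slater_sum_antisymmetric (f : Hxxz) :
  Ell2 (slater_sum_summable f) \in @antisymmetric_pred R N.
Proof. by apply/antisymmetricP => s x; exact: slater_sum_permute. Qed.

Definition to_antisymmetric (f : Hxxz) : ell2a R N :=
  Ell2a (slater_sum_antisymmetric f).

(** By [slater_sumK] these values extend back to [g], so their squared norm is that of [g]. *)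
Lemma config_values_summable (g : ell2a R N) :
  (fun J => (c^-1)%:C * g (config_sites J) : R[i]^o) \in @square_summable R (config N).
Proof.
apply/square_summableP; rewrite -sqnorm_slater_sum.
by rewrite (slater_sumK (antisymmetricP _ (valP g))) ell2_summable.
Qed.

Definition from_antisymmetric (g : ell2a R N) : Hxxz :=
  Ell2 (config_values_summable g).

Lemma to_antisymmetricK : cancel to_antisymmetric from_antisymmetric.
Proof.
move=> f; apply/ell2P => J.
transitivity ((c^-1)%:C * slater_sum f (config_sites J)) => //.
rewrite slater_sum_config mulrA -rmorphM/= mulVf ?mul1r//.
by rewrite gt_eqF// slater_norm_gt0.
Qed.

Lemma from_antisymmetricK : cancel from_antisymmetric to_antisymmetric.
Proof.
move=> g; apply/val_inj/ell2P => x.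
by have /(congr1 (@^~ x)) := slater_sumK (antisymmetricP _ (valP g)).
Qed.

Lemma to_antisymmetric_linear : linear to_antisymmetric.
Proof.
move=> a f g; apply/val_inj/ell2P => x.
transitivity (slater_sum (fun J => a * f J + g J) x) => //.
transitivity (a * slater_sum f x + slater_sum g x) => //.
rewrite /slater_sum; case: (config_of x) => [J|]/=; last by rewrite mulr0 addr0.
by rewrite mulrDr mulrCA.
Qed.

(** The common factor [a] of the two values at a tuple is real with square 1/N!, the weight in
    [csum_sites]. *)
Lemma dot_to_antisymmetric f g :
  dot (to_antisymmetric f) (to_antisymmetric g) = dot f g.
Proof.
rewrite /dot -csum_sites; congr csum; apply/funext => x.
transitivity ((slater_sum f x)^* * slater_sum g x) => //.
rewrite /slater_sum; case E : (config_of x) => [J|]; last by rewrite /= mulr0.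
transitivity ((c%:C * (orientation x)%:~R * f J)^* *
              (c%:C * (orientation x)%:~R * g J)) => //.
transitivity ((N`!%:R^-1)%:C * ((f J)^* * g J)) => //.
set a : R[i] := c%:C * (orientation x)%:~R.
have aa : a * a = (N`!%:R^-1)%:C.
  rewrite /a mulrACA -intrM -[(_ * _)%R in X in _ * X]expr2 (orientation_sqr E) mulr1.
  by rewrite -rmorphM/= -expr2 slater_norm_sqr.
have aC : a^* = a.
  rewrite /a (_ : (orientation x)%:~R = ((orientation x)%:~R : R)%:C).
    by rewrite -rmorphM/=; exact: conjc_real.
  by rewrite (rmorph_int (real_complex R)).
transitivity (a * (f J)^* * (a * g J)); last by rewrite mulrACA aa.
congr (_ * _); apply: etrans (rmorphM (@Num.conj R[i]) _ _) _.
by congr (_ * _); exact: aC.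
Qed.

(** Compare at a tuple [y]. Both sides vanish if [y] has coinciding coordinates or occupies another
    configuration. Otherwise [y] is [permute t x] for exactly one [t], and only that term of the
    Slater sum survives, with the sign given by the orientation. *)
Lemma slaterE (J : config N) x : increasing x -> image_set x = val J ->
  val (to_antisymmetric (delta J)) = slater R x.
Proof.
move=> xi xJ; apply/ell2P => y; rewrite /slater ell2ZE ell2_sumE.
transitivity (slater_sum (fun K => (K == J)%:R : R[i]) y) => //.
rewrite /slater_sum.
have xI := increasing_injective xi.
case: sitesP => [K s ys|k l kl ykl]; last first.
  rewrite big1 ?mulr0// => s _; rewrite ell2ZE/=.
  case: eqVneq => [yx|]; last by rewrite mulr0.
  by move: ykl kl; rewrite yx !ffunE => /xI/perm_inj ->; rewrite eqxx.
transitivity (c%:C * (orientation y)%:~R * (K == J)%:R : R[i]) => //.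
rewrite -mulrA; congr (_ * _).
have [KJ|KJ] := eqVneq K J; last first.
  rewrite mulr0 big1// => t _; rewrite ell2ZE/=.
  case: eqVneq => [yx|]; last by rewrite mulr0.
  have /eqP[] := KJ; apply: val_inj.
  by rewrite -xJ -image_config_sites -(image_set_permute s) -ys yx image_set_permute.
have [t yt] : exists t : 'S_N, y = permute t x.
  apply: permute_of_image => //.
  by rewrite xJ -KJ ys image_set_permute image_config_sites.
rewrite (bigD1 t)// big1 ?addr0; last first.
  move=> s' s't; rewrite ell2ZE/= yt.
  by rewrite (inj_eq (permute_inj xI)) eq_sym (negPf s't) mulr0.
rewrite ell2ZE/= yt eqxx mulr1 mulr1.
by rewrite orientation_permute orientation_increasing// mulr1 rmorph_sign addr0.
Qed.

Lemma to_antisymmetric_canonical : is_canonical_unitary to_antisymmetric.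
Proof.
split.
- exact: to_antisymmetric_linear.
- by exists from_antisymmetric; [exact: to_antisymmetricK|exact: from_antisymmetricK].
- exact: dot_to_antisymmetric.
- by move=> x J xi xJ; exact: slaterE.
Qed.

(** Both maps preserve inner products and agree on the basis, so [f] and the preimage of [V f] under
    [U] have the same inner product with every [delta J]. *)
Lemma canonical_unitary_unique (U V : Hxxz -> ell2a R N) :
  is_canonical_unitary U -> is_canonical_unitary V -> U = V.
Proof.
move=> [_ [U' UK U'K] Ui Ub] [_ _ Vi Vb]; apply/funext => f.
suff fE : f = U' (V f) by rewrite {1}fE U'K.
apply/ell2P => J; have xi := config_sites_increasing J.
have xJ : val J = image_set (config_sites J) by rewrite image_config_sites.
have /val_inj VU : val (V (delta J)) = val (U (delta J)).
  by rewrite (Vb _ _ xi xJ) (Ub _ _ xi xJ).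
have : dot (delta J) f = dot (delta J) (U' (V f)).
  by rewrite -(Vi (delta J) f) -(Ui (delta J) (U' (V f))) U'K VU.
by rewrite !dot_delta.
Qed.

End Unitary.

(** * Hops of one particle as spin exchanges, and the count of domain walls *)

Section Sites.
Variables (R : realType) (N : nat).

Notation sites := {ffun 'I_N -> int}.
Notation c := (slater_norm R N).

Lemma big_config (V : nmodType) (J : config N) (F : int -> V) :
  \sum_(y <- val J) F y = \sum_(k < N) F (config_sites J k).
Proof.
rewrite -image_config_sites big_imfset/=.
  by rewrite big_enum.
by move=> k l _ _; exact/increasing_injective/config_sites_increasing.
Qed.

Lemma config_sites_in (J : config N) k : config_sites J k \in val J.
Proof. by rewrite -image_config_sites; apply/image_setP; exists k. Qed.

Lemma transpositionE (z y : int) : transposition z y =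
  if y == z then z + 1 else if y == z + 1 then z else y.
Proof. by []. Qed.

Definition transpose_sites z (x : sites) : sites := [ffun k => transposition z (x k)].

Lemma transpose_sitesE z x k : transpose_sites z x k = transposition z (x k).
Proof. by rewrite ffunE. Qed.

Lemma updateE (x : sites) j y k : update x j y k = if k == j then y else x k.
Proof. by rewrite ffunE. Qed.

Lemma val_exchange z (J : config N) :
  val (exchange z J) = image_set (transpose_sites z (config_sites J)).
Proof.
apply/fsetP => y; apply/imfsetP/image_setP => [[t /= ]|[k ->]].
  rewrite -image_config_sites => /image_setP[k ->] ->.
  by exists k; rewrite transpose_sitesE.
by exists (config_sites J k); rewrite /= ?config_sites_in ?transpose_sitesE//.
Qed.

(** Hence exchanging the sites [z] and [z + 1] keeps an increasing tuple increasing, unless both are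
    occupied. *)
Lemma transposition_lt (z a b : int) : a < b -> ~ (a = z /\ b = z + 1) ->
  transposition z a < transposition z b.
Proof.
rewrite !transpositionE.
by case: (eqVneq a z); case: (eqVneq b z); case: (eqVneq a (z + 1));
  case: (eqVneq b (z + 1)); lia.
Qed.

Lemma slater_sum_exchange (f : config N -> R[i]) (J : config N) z :
  ~~ ((z \in val J) && (z + 1 \in val J)) ->
  slater_sum f (transpose_sites z (config_sites J)) =
  c%:C * f (exchange z J).
Proof.
move=> zJ; rewrite /slater_sum /config_of -val_exchange valK/=.
rewrite orientation_increasing ?mulr1// => k l kl.
rewrite !transpose_sitesE; apply: transposition_lt; first exact: config_sites_increasing.
by move=> [ka lb]; move: zJ; rewrite -lb -{1}ka !config_sites_in.
Qed.

Lemma slater_sum_eq0 (f : config N -> R[i]) (x : sites) k l :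
  k != l -> x k = x l -> slater_sum f x = 0.
Proof.
by apply: antisymmetric_eq0 => s; exact: slater_sum_permute.
Qed.

(** The site [y] is held by a particle other than [j], so the hop makes two coordinates coincide. *)
Lemma slater_sum_update_in (f : config N -> R[i]) (J : config N) j y :
  y != config_sites J j -> y \in val J ->
  slater_sum f (update (config_sites J) j y) = 0.
Proof.
move=> yj; rewrite -image_config_sites => /image_setP[l yl].
have lj : l != j by apply: contraNneq yj => <-; rewrite yl.
by apply: (slater_sum_eq0 _ lj); rewrite !updateE eqxx (negPf lj).
Qed.

(** A hop onto an occupied site gives 0. If [y + 1] is empty, particle [j] is the only one on the
    bond, so moving it is the same as transposing the bond. *)
Lemma slater_sum_right (f : config N -> R[i]) (J : config N) j :
  let y := config_sites J j in
  slater_sum f (update (config_sites J) j (y + 1)) =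
  c%:C * ((y + 1 \notin val J)%:R * f (exchange y J)).
Proof.
move=> y; rewrite mulr_natl mulrb; case: ifPn => [yJ|/negPn yJ]; last first.
  by rewrite mulr0 slater_sum_update_in// /y; lia.
rewrite -slater_sum_exchange ?(negPf yJ) ?andbF//; congr slater_sum.
apply/ffunP => k; rewrite updateE transpose_sitesE transpositionE ?subrK.
case: eqVneq => [->|kj]; first by rewrite eqxx.
rewrite (negPf (_ : config_sites J k != y)); last first.
  by rewrite (inj_eq (increasing_injective (config_sites_increasing J))).
by case: eqVneq => // ky; move: yJ; rewrite -ky config_sites_in.
Qed.

(** As for the hop to the right, but the bond is named by its left end, now [y - 1]. *)
Lemma slater_sum_left (f : config N -> R[i]) (J : config N) j :
  let y := config_sites J j in
  slater_sum f (update (config_sites J) j (y - 1)) =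
  c%:C * ((y - 1 \notin val J)%:R * f (exchange (y - 1) J)).
Proof.
move=> y; rewrite mulr_natl mulrb; case: ifPn => [yJ|/negPn yJ]; last first.
  by rewrite mulr0 slater_sum_update_in// /y; lia.
rewrite -slater_sum_exchange ?(negPf yJ)//; congr slater_sum.
apply/ffunP => k; rewrite updateE transpose_sitesE transpositionE subrK.
case: (eqVneq k j) => [->|kj]; first by rewrite /y eqxx; case: eqVneq => //; lia.
rewrite [config_sites J k == y]negbTE; last first.
  by rewrite (inj_eq (increasing_injective (config_sites_increasing J))).
by case: eqVneq => // ky; move: yJ; rewrite -ky config_sites_in.
Qed.

Lemma sum_eq_site (K : pzSemiRingType) (x : sites) y : injective x ->
  \sum_(l < N) (x l == y)%:R = (y \in image_set x)%:R :> K.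
Proof.
move=> xI; case: image_setP => [[k ->]|yx].
  by rewrite (bigD1 k)//= eqxx big1 ?addr0// => l lk; rewrite (inj_eq xI) (negPf lk).
by rewrite big1// => l _; case: eqVneq => // xl; case: yx; exists l.
Qed.

(* Each particle has two neighbouring sites, and [interaction] counts, with sign,
   the pairs of neighbouring particles; what remains are the domain walls. *)
Lemma domain_walls (J : config N) :
  \sum_(k < N) ((config_sites J k + 1 \notin val J)%:R +
                (config_sites J k - 1 \notin val J)%:R) =
  2 * (N%:R + interaction R (config_sites J)) :> R.
Proof.
set x := config_sites J.
have xI : injective x := increasing_injective (config_sites_increasing J).
rewrite mulrDr ![2 * _]mulr_natl interaction2.
rewrite [N%:R *+ 2](_ : _ = \sum_(k < N) 2); last first.
  by rewrite sumr_const card_ord -!mulrnA mulnC.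
rewrite -big_split/=; apply: eq_bigr => k _.
(* A partner at distance 1 sits at [x k + 1] or at [x k - 1]. The index [l = k] may be added, since
   [x k] is neither of these. *)
have -> : \sum_(l < N | l != k) pairQ R `|x k - x l|%N =
    - ((x k + 1 \in val J)%:R + (x k - 1 \in val J)%:R).
  rewrite -image_config_sites -!(sum_eq_site _ _ xI) -big_split -sumrN/=.
  have kr : (x k == x k + 1) = false by lia.
  have kl : (x k == x k - 1) = false by lia.
  rewrite [RHS](bigD1 k)//= kr kl addr0 oppr0 add0r.
  apply: eq_bigr => l lk.
  have {}lk : x l != x k by rewrite (inj_eq xI).
  rewrite /pairQ; case: (eqVneq (x l) (x k + 1)) => [->|h1].
    have -> : (absz (x k - (x k + 1))%R == 1%N) by lia.
    have -> : (x k + 1 == x k - 1) = false by lia.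
    by rewrite addr0.
  case: (eqVneq (x l) (x k - 1)) => [->|h2].
    have -> : (absz (x k - (x k - 1))%R == 1%N) by lia.
    by rewrite add0r.
  have -> : (absz (x k - x l)%R == 1%N) = false by lia.
  by rewrite addr0 oppr0.
by case: (_ + 1 \in _); case: (_ - 1 \in _); rewrite /=; ring.
Qed.

End Sites.

(** * Both operators evaluated at a configuration, as one and the same sum over particles *)

Section Hamiltonian.
Variables (R : realType) (N : nat) (Delta : R) (nu : int -> R)
  (nu_bounded : bounded_family nu).

Notation sites := {ffun 'I_N -> int}.
Notation Hxxz := (ell2 R (config N)).

Lemma exchange_id x (J : config N) :
  (x \in val J) = (x + 1 \in val J) -> exchange x J = J.
Proof.
have [xJ x1J|xJ /esym/negbT x1J] := boolP (x \in val J); last first.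
  exact: transposition_notin.
apply/val_inj/fsetP => y; apply/imfsetP/idP => [[z /= zJ ->]|yJ].
  by rewrite transpositionE; case: ifP => // _; case: ifP.
exists (transposition x y); last by rewrite transpositionK.
by rewrite transpositionE; case: ifP => // _; case: ifP.
Qed.

Lemma bond_signE x (J : config N) :
  bond_sign R x J = if (x \in val J) == (x + 1 \in val J) then 1 else -1.
Proof.
have xx1 : x != x + 1 by lia.
rewrite /bond_sign fsetIUr cardfsU !fsetI1.
case: (x \in val J); case: (x + 1 \in val J);
  rewrite ?fsetI0 ?fset0I ?cardfs0 ?cardfs1 //=.
rewrite (_ : (_ `&` _)%fset = fset0) ?cardfs0//.
by apply/fsetP => y; rewrite !inE; case: (eqVneq y x) => // ->; apply/negbTE.
Qed.

(** The action of a bond with exactly one down-spin. The parity is -1 there, so the diagonal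
    coefficient is 1/(2 Delta) + (1 - 1/Delta)/2 = 1/2. *)
Definition wall_term (f : config N -> R[i]) (J : config N) x : R[i] :=
  - ((2 * Delta)^-1)%:C * f (exchange x J) + (2^-1)%:C * f J.

(** If the two spins agree, exchange and parity both act as the identity and the bond contributes
    nothing. *)
Lemma bondE (f : Hxxz) x (J : config N) : Delta != 0 ->
  bond Delta x f J =
  ((x \in val J) != (x + 1 \in val J))%:R * wall_term f J x.
Proof.
move=> D0.
transitivity (- ((2 * Delta)^-1)%:C * (f (exchange x J) - f J)
    - (4^-1 * (1 - Delta^-1))%:C * ((bond_sign R x J)%:C * f J - f J)) => //.
rewrite bond_signE; have [xx|xx] := eqVneq (x \in val J) (x + 1 \in val J).
  by rewrite exchange_id// mul1r subrr !mulr0 subrr mul0r.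
rewrite mul1r /wall_term [in RHS](_ : (2^-1)%:C = ((2 * Delta)^-1)%:C +
    (4^-1 * (1 - Delta^-1))%:C * 2); last first.
  rewrite (_ : 2 = 2%:C); last by rewrite rmorph_nat.
  rewrite -rmorphM -rmorphD/=; congr (_%:C); by field.
rewrite rmorphN1; ring.
Qed.

(** Each domain wall is charged to its single down-spin: [t1] collects the bonds with a particle at
    the left end, together with the field, and [t2] those with a particle at the right end. The
    shift x = y - 1 turns [t2] into a sum over particles. *)
Lemma xxz0E (f : Hxxz) (J : config N) : Delta != 0 -> finite_combinations f ->
  xxz0 Delta nu f J = \sum_(k < N)
    let y := config_sites J k in
    ((y + 1 \notin val J)%:R * wall_term f J y +
     (y - 1 \notin val J)%:R * wall_term f J (y - 1) + (nu y)%:C * f J).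
Proof.
move=> D0 ff.
pose F x : Hxxz := bond Delta x f + (nu x)%:C *: Defs.number x f.
have finF : finite_set [set x | F x != 0] := xxz0_finite Delta nu ff.
have F0 x : x \notin fset_set [set x | F x != 0] -> F x = 0.
  by rewrite in_fset_set// notin_setE/= => /negP/negPn/eqP.
(* Passing through a finite support lets evaluation at [J] enter the sum over all bonds. *)
rewrite /xxz0 (fsbigTE _ _ F0) ell2_sumE.
rewrite -(@fsbigTE _ _ _ _ _ (fun x => F x J)); last first.
  by move=> x /F0 ->.
pose t1 x := (x \in val J)%:R *
  ((x + 1 \notin val J)%:R * wall_term f J x + (nu x)%:C * f J).
pose t2 x := (x + 1 \in val J)%:R * ((x \notin val J)%:R * wall_term f J x).
have FE x : F x J = t1 x + t2 x.
  transitivity (bond Delta x f J + (nu x)%:C * ((occupation R x J)%:C * f J)) => //.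
  rewrite bondE// /t1 /t2 /occupation rmorph_nat.
  by case: (x \in val J); case: (x + 1 \in val J); rewrite /=; ring.
(* The left ends of bonds with occupied right end, which support [t2]. *)
pose J' := [fset (y - 1)%R | y in val J]%fset.
have J'E x : (x \in J') = (x + 1 \in val J).
  apply/imfsetP/idP => [[y /= yJ ->]|xJ]; first by rewrite subrK.
  by exists (x + 1); rewrite ?addrK.
have t1E x : x \notin val J -> t1 x = 0 by move=> /negPf xJ; rewrite /t1 xJ mul0r.
have t2E x : x \notin J' -> t2 x = 0 by rewrite J'E => /negPf xJ; rewrite /t2 xJ mul0r.
rewrite (@fsbigTE _ _ _ _ (val J `|` J')%fset); last first.
  by move=> x; rewrite in_fsetU negb_or => /andP[xJ xJ']; rewrite FE t1E// t2E// addr0.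
rewrite (eq_bigr _ (fun x _ => FE x)) big_split/=.
rewrite -(big_fset_incl _ (fsubsetUl (val J) J')); last by move=> x _; exact: t1E.
rewrite -(big_fset_incl _ (fsubsetUr (val J) J')); last by move=> x _; exact: t2E.
rewrite big_imfset /=; last by move=> y z _ _ /addIr.
rewrite -big_split/= big_config; apply: eq_bigr => k _.
by rewrite /t1 /t2 subrK config_sites_in !mul1r addrAC.
Qed.

Definition hamiltonian (f : Hxxz) : Hxxz :=
  from_antisymmetric
    (schrodinger_a Delta nu_bounded (to_antisymmetric f) + N%:R *: to_antisymmetric f).

(** At the increasing tuple of [J] the hops become exchanges across domain walls, while
    [domain_walls] spreads N + W over the walls, one half for each. This produces [wall_term]. *)
Lemma hamiltonianE (f : Hxxz) (J : config N) :
  hamiltonian f J = \sum_(k < N)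
    let y := config_sites J k in
    ((y + 1 \notin val J)%:R * wall_term f J y +
     (y - 1 \notin val J)%:R * wall_term f J (y - 1) + (nu y)%:C * f J).
Proof.
set x := config_sites J; set c := slater_norm R N.
pose F := slater_sum f.
have c0 : (c^-1)%:C * c%:C = 1 :> R[i].
  by rewrite -rmorphM/= mulVf// gt_eqF// slater_norm_gt0.
transitivity ((c^-1)%:C * (- ((2 * Delta)^-1)%:C *
   (\sum_(j < N) hop j (to_antisymmetric f : ell2 R sites) : ell2 R sites) x
   + (potential nu x)%:C * F x + (interaction R x)%:C * F x + N%:R * F x)) => //.
rewrite ell2_sumE.
have hopE j : hop j (to_antisymmetric f : ell2 R sites) x =
  c%:C * ((x j - 1 \notin val J)%:R * f (exchange (x j - 1) J) +
          (x j + 1 \notin val J)%:R * f (exchange (x j) J)).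
  transitivity (F (update x j (x j - 1)) + F (update x j (x j + 1))) => //.
  by rewrite /F slater_sum_left slater_sum_right mulrDr.
rewrite (eq_bigr _ (fun j _ => hopE j)) -mulr_sumr /F slater_sum_config -/c.
have walls : \sum_(k < N) ((x k + 1 \notin val J)%:R + (x k - 1 \notin val J)%:R) =
    (2 * (N%:R + interaction R x))%:C :> R[i].
  rewrite -domain_walls rmorph_sum; apply: eq_bigr => k _.
  by rewrite rmorphD !rmorph_nat.
set S := \sum_(i < N) _; rewrite [LHS](_ : _ = (c^-1)%:C * c%:C *
   (- ((2 * Delta)^-1)%:C * S +
    (potential nu x)%:C * f J + (N%:R + (interaction R x)%:C) * f J)); last first.
  by move: (potential nu x)%:C (interaction R x)%:C (c^-1)%:C c%:C S => v w a b r; ring.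
rewrite c0 mul1r (_ : N%:R + _ = (2^-1)%:C *
    \sum_(k < N) ((x k + 1 \notin val J)%:R + (x k - 1 \notin val J)%:R)); last first.
  by rewrite walls -rmorphM/= mulrA mulVf ?mul1r// rmorphD rmorph_nat.
rewrite /potential rmorph_sum mulr_suml !mulr_sumr mulr_suml -!big_split/=.
apply: eq_bigr => k _; rewrite /wall_term -/x; move: (_^-1)%:C => a.
ring.
Qed.

End Hamiltonian.

(** * Boundedness of the conjugated Schrödinger operator *)

Section Bounded.
Variables (R : realType) (N : nat) (Delta : R) (nu : int -> R)
  (nu_bounded : bounded_family nu).

Notation sites := {ffun 'I_N -> int}.
Notation Hxxz := (ell2 R (config N)).

Lemma rnorm_to_antisymmetric (f : Hxxz) : rnorm (to_antisymmetric f) = rnorm f.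
Proof. by congr (Num.sqrt (fine _)); exact: sqnorm_slater_sum. Qed.

Lemma rnorm_from_antisymmetric (g : ell2a R N) :
  rnorm (from_antisymmetric g) = rnorm g.
Proof. by rewrite -rnorm_to_antisymmetric from_antisymmetricK. Qed.

Lemma rnorm_hop (j : 'I_N) (f : ell2 R sites) : rnorm (hop j f) <= 2 * rnorm f.
Proof.
have -> : hop j f = composition (@update_inj N j (- 1)) f +
                    composition (@update_inj N j 1) f.
  exact/ell2P.
rewrite mulr_natl mulr2n (le_trans (rnormD _ _))//.
by rewrite lerD// rnorm_composition.
Qed.

Lemma rnorm_schrodinger :
  exists2 M, 0 <= M &
  forall f : ell2 R sites, rnorm (schrodinger Delta nu_bounded f) <= M * rnorm f.
Proof.
have [V V0 VP] := rnorm_multiplication (@potential_bounded R N _ nu_bounded).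
have [W W0 WP] := rnorm_multiplication (@interaction_bounded R N).
rewrite /schrodinger; move: (- ((2 * Delta)^-1)%:C) => a.
(* Each of the N hops is a sum of two compositions with injective shifts, hence has norm at most
   2. *)
exists (normc a * (2 *+ N) + V + W) => [|f].
  by rewrite !addr_ge0// mulr_ge0 ?normc_ge0 ?mulrn_wge0.
rewrite !mulrDl (le_trans (rnormD _ _))// lerD// (le_trans (rnormD _ _))// lerD//.
rewrite rnormZ -mulrA ler_wpM2l ?normc_ge0//.
have -> : 2 *+ N = \sum_(j < N) 2 :> R by rewrite sumr_const card_ord.
rewrite mulr_suml.
elim/big_ind2: _ => [|u x v y ux vy|j _]; last exact: rnorm_hop.
  by rewrite /rnorm /sqnorm esum1 ?sqrtr0// => i _; rewrite [normc _]normc0 expr0n.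
by apply: le_trans (rnormD _ _) _; rewrite lerD.
Qed.

(** Turns the norm bound into the Lipschitz bound required by [closure_graph]. *)
Lemma hamiltonianB (f g : Hxxz) :
  hamiltonian Delta nu_bounded (f - g) =
  hamiltonian Delta nu_bounded f - hamiltonian Delta nu_bounded g.
Proof.
apply/ell2P => J.
have BE (h1 h2 : Hxxz) K : (h1 - h2) K = h1 K - h2 K by [].
rewrite BE !hamiltonianE -sumrB; apply: eq_bigr => k _.
rewrite /wall_term !BE; move: (_^-1)%:C => a; move: (_^-1)%:C => b; ring.
Qed.

Lemma rnorm_hamiltonian : exists2 M, 0 <= M &
  forall f : Hxxz, rnorm (hamiltonian Delta nu_bounded f) <= M * rnorm f.
Proof.
have [M M0 MP] := rnorm_schrodinger.
exists (M + normc (N%:R : R[i])) => [|f]; first by rewrite addr_ge0 ?normc_ge0.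
rewrite /hamiltonian rnorm_from_antisymmetric.
rewrite [X in rnorm X <= _](_ : _ = schrodinger Delta nu_bounded (to_antisymmetric f) +
  N%:R *: (to_antisymmetric f : ell2 R sites))//.
apply: le_trans (rnormD _ _) _.
rewrite rnormZ mulrDl !rnorm_to_antisymmetric lerD// (le_trans (MP _))//.
by rewrite rnorm_to_antisymmetric.
Qed.

Lemma xxz_hamiltonian (f : Hxxz) : Delta != 0 -> finite_combinations f ->
  xxz0 Delta nu f = hamiltonian Delta nu_bounded f.
Proof. by move=> D0 ff; apply/ell2P => J; rewrite xxz0E// hamiltonianE. Qed.

End Bounded.

Theorem proposition4p1 (R : realType) (Delta : R) (Delta_gt1 : 1 < Delta)
    (nu : int -> R) (nu_bounded : bounded_family nu)
    (nu_ge0 : forall x, 0 <= nu x) (N : nat) :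
  exists (U : ell2 R (config N) -> ell2a R N) (Uinv : ell2a R N -> ell2 R (config N)),
    [/\ unique (@is_canonical_unitary R N) U,
        cancel U Uinv, cancel Uinv U &
        xxz_graph Delta nu =
        graph (fun f : ell2 R (config N) =>
                 Uinv (schrodinger_a Delta nu_bounded (U f) + N%:R *: U f))].
Proof.
exists (@to_antisymmetric R N), (@from_antisymmetric R N); split.
- split; first exact: to_antisymmetric_canonical.
  by move=> V; apply: canonical_unitary_unique; exact: to_antisymmetric_canonical.
- exact: to_antisymmetricK.
- exact: from_antisymmetricK.
have D0 : Delta != 0 by rewrite gt_eqF// (lt_trans ltr01).
have [M M0 MP] := rnorm_hamiltonian N Delta nu_bounded.
(* The full graph is the closure of its part above finite combinations, so only these remain to be
   compared. *)
rewrite -(@closure_graph _ _ _ (hamiltonian Delta nu_bounded) M)//; last first.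
  by move=> f g; rewrite -hamiltonianB.
rewrite /xxz_graph; congr closure; apply/seteqP; split=> _ [f ff <-]; exists f => //.
  by rewrite xxz_hamiltonian.
by rewrite xxz_hamiltonian.
Qed.
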